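(* Let $R$ be an integral domain (not a field) that is finitely stable and an LPI-domain, and assume every nonzero prime ideal of $R$ is contained in a unique maximal ideal (for instance, $R$ is one-dimensional). Then $R$ has finite character.
   Context: Let $R$ be an integral domain with quotient field $K\neq R$. For a nonzero ideal $I$ of $R$, $E(I):=(I:I)=\{x\in K: xI\subseteq I\}$. An ideal $I$ is locally principal if $IR_M$ is principal for every maximal ideal $M$ of $R$; it is invertible if $I(R:I)=R$, where $(R:I)=\{x\in K: xI\subseteq R\}$. $R$ is an LPI-domain if every locally principal nonzero ideal of $R$ is invertible. A nonzero ideal $I$ is stable if it is invertible as an ideal of the ring $E(I)$; $R$ is finitely stable if every nonzero finitely generated ideal of $R$ is stable. $R$ has finite character if every nonzero element of $R$ lies in only finitely many maximal ideals of $R$. *)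

(* Defs.v *)
(* An integral domain R is represented as a subring of a
   field K which is its quotient field (every element is a/b, a,b in R). *)
From HB Require Import structures.
From mathcomp Require Import all_boot all_order all_algebra.
Set Implicit Arguments. Unset Strict Implicit. Unset Printing Implicit Defensive.
Import GRing.Theory.
Local Open Scope ring_scope.

Section Defs.
Variable K : fieldType.

Definition subset (A B : K -> Prop) : Prop := forall x, A x -> B x.
Definition seteq (A B : K -> Prop) : Prop := forall x, A x <-> B x.

Definition is_subring (R : K -> Prop) : Prop :=
  [/\ R 0, R 1, (forall x y, R x -> R y -> R (x - y)) &
      (forall x y, R x -> R y -> R (x * y))].

Definition is_quotient_field (R : K -> Prop) : Prop :=
  forall x : K, exists a b, [/\ R a, R b, b != 0 & x = a / b].

Definition span (T S : K -> Prop) : K -> Prop :=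
  fun x => forall X : K -> Prop,
    subset S X -> X 0 -> (forall a b, X a -> X b -> X (a + b)) ->
    (forall t a, T t -> X a -> X (t * a)) -> X x.

Definition prodT (T I J : K -> Prop) : K -> Prop :=
  span T (fun z => exists x y, [/\ I x, J y & z = x * y]).

Definition colon (T I : K -> Prop) : K -> Prop :=
  fun x => forall y, I y -> T (x * y).

Definition is_ideal (R I : K -> Prop) : Prop :=
  [/\ subset I R, I 0, (forall a b, I a -> I b -> I (a + b)) &
      (forall r a, R r -> I a -> I (r * a))].

Definition nonzero (I : K -> Prop) : Prop := exists x, I x /\ x != 0.

Definition is_prime (R P : K -> Prop) : Prop :=
  [/\ is_ideal R P, ~ P 1 &
      forall a b, R a -> R b -> P (a * b) -> P a \/ P b].

Definition is_maximal (R M : K -> Prop) : Prop :=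
  [/\ is_ideal R M, ~ M 1 &
      forall J, is_ideal R J -> subset M J -> seteq J M \/ J 1].

Definition localization (R M : K -> Prop) : K -> Prop :=
  fun x => exists a s, [/\ R a, R s, ~ M s & x = a / s].

Definition extend (R M I : K -> Prop) : K -> Prop := span (localization R M) I.

Definition principal (T I : K -> Prop) : Prop :=
  exists x, seteq I (fun z => exists t, T t /\ z = x * t).

Definition locally_principal (R I : K -> Prop) : Prop :=
  forall M, is_maximal R M -> principal (localization R M) (extend R M I).

Definition invertible (T I : K -> Prop) : Prop :=
  seteq (prodT T I (colon T I)) T.

Definition LPI (R : K -> Prop) : Prop :=
  forall I, is_ideal R I -> nonzero I -> locally_principal R I -> invertible R I.

Definition endo (I : K -> Prop) : K -> Prop := colon I I.

Definition stable (I : K -> Prop) : Prop := invertible (endo I) I.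

Definition finitely_generated (R I : K -> Prop) : Prop :=
  exists s : seq K, (forall x, x \in s -> R x) /\
    seteq I (span R (fun x => x \in s)).

Definition finitely_stable (R : K -> Prop) : Prop :=
  forall I, is_ideal R I -> nonzero I -> finitely_generated R I -> stable I.

Definition finite_character (R : K -> Prop) : Prop :=
  forall x, R x -> x != 0 ->
    exists Ms : seq (K -> Prop),
      forall M, is_maximal R M -> M x -> exists2 i, (i < size Ms)%N & seteq M (nth (fun _ => False) Ms i).

Definition prime_in_unique_maximal (R : K -> Prop) : Prop :=
  forall P, is_prime R P -> nonzero P ->
    exists M, [/\ is_maximal R M, subset P M &
      forall M', is_maximal R M' -> subset P M' -> seteq M' M].

End Defs.

(* Main.v *)
From mathcomp Require Import all_boot all_order all_algebra.
From mathcomp Require Import boolp ring.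
From mathcomp Require classical_sets.
Require Import Defs.

(** Fix [x != 0] and a maximal ideal [M].  As no nonzero prime lies in two
    maximal ideals, [R_M R_N = K] for [N <> M], so that [J = x R_M ∩ R] is
    contained in no maximal ideal other than [M].  Hence [J] is locally
    principal, so invertible by LPI.  The ideal [x J^-1] then is not contained
    in [M], but is contained in [x R_N] for every [N <> M].  Consequently the
    ideal of all [r] lying in [x R_N] for all but finitely many [N] is contained
    in no maximal ideal; it contains [1], i.e. [x] is a unit of [R_N] for all
    but finitely many [N]. *)

Set Implicit Arguments.
Unset Strict Implicit.
Unset Printing Implicit Defensive.
Import GRing.Theory.
Local Open Scope ring_scope.

Section Ideals.
Variables (K : fieldType) (R : K -> Prop).
Hypothesis subR : is_subring R.

(** * Elementary facts on subrings and ideals *)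

Lemma seteq_eq (A B : K -> Prop) : seteq A B -> A = B.
Proof. by move=> AB; apply/funext => z; apply/propext. Qed.

Lemma subring_add a b : R a -> R b -> R (a + b).
Proof.
case: subR => R0 _ RB _ Ra Rb.
by rewrite -[b]opprK -[- b]sub0r; apply: (RB) => //; apply: RB.
Qed.

Lemma ideal_add_principal I a : is_ideal R I -> R a ->
  is_ideal R (fun z => exists i r, [/\ I i, R r & z = i + r * a]).
Proof.
case: subR => R0 _ _ RM [IR I0 ID IM] Ra; split.
- by move=> _ [i [r [Ii Rr ->]]]; apply: subring_add; [apply: IR | apply: RM].
- by exists 0, 0; rewrite mul0r addr0.
- move=> _ _ [i [r [Ii Rr ->]]] [j [s [Ij Rs ->]]].
  exists (i + j), (r + s); split; [exact: ID | exact: subring_add | ring].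
- move=> t _ Rt [i [r [Ii Rr ->]]].
  by exists (t * i), (t * r); split; [exact: IM | exact: RM | ring].
Qed.

(** * Ideals maximal among those disjoint from a set *)

Definition disjoint_from (S I : K -> Prop) : Prop := forall z, S z -> ~ I z.

Definition maximal_disjoint_from (S P : K -> Prop) : Prop :=
  [/\ is_ideal R P, disjoint_from S P &
      forall J, is_ideal R J -> subset P J -> disjoint_from S J -> subset J P].

(** Zorn's lemma. Taking {1} for [S] yields maximal ideals; taking the product of two complements
    yields a prime inside two maximal ideals. *)
Lemma exists_maximal_disjoint_from S I :
  is_ideal R I -> disjoint_from S I ->
  exists P, maximal_disjoint_from S P /\ subset I P.
Proof.
move=> idI SI.
pose good X := [/\ is_ideal R X, disjoint_from S X & subset I X].
(* The empty set is admitted as well, since it is the union of the empty chain. *)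
pose admissible (X : K -> Prop) := X = (fun=> False) \/ good X.
have goodI : good I by split.
have [F Fadm Ftot|P [admP maxP]] := @classical_sets.Zorn_bigcup _ admissible.
  have [[X [FX goodX]]|noX] := pselect (exists X, F X /\ good X); last first.
    left; apply/seteq_eq => z; split=> // -[X FX Xz]; apply: noX; exists X.
    by split=> //; case: (Fadm _ FX) => // X0; move: Xz; rewrite X0.
  have goodF Y z : F Y -> Y z -> good Y.
    by move=> FY Yz; case: (Fadm _ FY) => // Y0; move: Yz; rewrite Y0.
  right; case: (goodX) => -[XR X0 XD XM] SX IX; split; first split.
  - by move=> z [Y FY Yz]; have [[YR _ _ _] _ _] := goodF _ _ FY Yz; apply: YR.
  - by exists X.
  - move=> a b [Y FY Ya] [Z FZ Zb].
    have [[_ _ YD _] _ _] := goodF _ _ FY Ya.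
    have [[_ _ ZD _] _ _] := goodF _ _ FZ Zb.
    case: (Ftot _ _ FY FZ) => [YZ|ZY].
      by exists Z => //; apply: ZD => //; apply: YZ.
    by exists Y => //; apply: YD => //; apply: ZY.
  - move=> r a Rr [Y FY Ya]; exists Y => //.
    by have [[_ _ _ YM] _ _] := goodF _ _ FY Ya; apply: YM.
  - by move=> z Sz [Y FY Yz]; have [_ SY _] := goodF _ _ FY Yz; apply: SY Yz.
  - by move=> z Iz; exists X => //; apply: IX.
(* The maximal element is not the empty set, because [I] is admissible and strictly larger. *)
case: admP => [P0|[idP SP IP]].
  have [_ I0 _ _] := idI; exfalso; apply: (maxP I); last by right.
  by rewrite P0; split=> [z//|/(_ _ I0)].
exists P; split=> //; split=> // J idJ PJ SJ z Jz.
apply: contrapT => nPz; apply: (maxP J).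
  by split=> // JP; apply: nPz; apply: JP.
by right; split=> // t /IP /PJ.
Qed.

(** If [a] and [b] lie outside [P], the larger ideals P + Ra and P + Rb both meet [S]; were [a * b]
    in [P], the product of the two common elements would lie in both [S] and [P]. *)
Lemma maximal_disjoint_from_prime S P :
  S 1 -> (forall a b, S a -> S b -> S (a * b)) ->
  maximal_disjoint_from S P -> is_prime R P.
Proof.
move=> S1 SM [idP SP maxP]; have [R0 R1 RB RM] := subR.
have [PR P0 PD PM] := idP; split=> //; first exact: SP.
have meetS a : R a -> ~ P a -> exists i r, [/\ P i, R r & S (i + r * a)].
  move=> Ra nPa; apply: contrapT => noS; apply: nPa.
  apply: (maxP _ (ideal_add_principal idP Ra)).
  - by move=> z Pz; exists z, 0; rewrite mul0r addr0.
  - by move=> z Sz [i [r [Pi Rr zE]]]; apply: noS; exists i, r; rewrite -zE.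
  - by exists 0, 1; rewrite mul1r add0r.
move=> a b Ra Rb Pab; apply: contrapT => /not_orP[nPa nPb].
have [i [r [Pi Rr Sa]]] := meetS _ Ra nPa.
have [j [s [Pj Rs Sb]]] := meetS _ Rb nPb.
apply: SP (SM _ _ Sa Sb) _.
(* Each summand is a multiple of [i], [j] or [a * b], all in [P]. *)
have -> : (i + r * a) * (j + s * b) =
    (j + s * b) * i + ((r * a) * j + (r * s) * (a * b)) by ring.
apply: (PD); first by apply: PM => //; apply: subring_add; [exact: PR | exact: RM].
by apply: PD; apply: PM => //; apply: RM.
Qed.

Lemma maximal_disjoint_from1 M :
  is_maximal R M <-> maximal_disjoint_from (fun z => z = 1) M.
Proof.
split=> [[idM nM1 maxM]|[idM SM maxM]]; split=> //.
- by move=> z ->.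
- move=> J idJ MJ SJ; case: (maxM _ idJ MJ) => [JM z /JM //|J1].
  by case: (SJ 1).
- exact: SM.
- move=> J idJ MJ; have [J1|nJ1] := pselect (J 1); [by right | left=> z].
  by split=> [|/MJ//]; apply: maxM => // _ ->.
Qed.

Lemma maximal_prime M : is_maximal R M -> is_prime R M.
Proof.
move=> /maximal_disjoint_from1; apply: maximal_disjoint_from_prime => //.
by move=> a b -> ->; rewrite mulr1.
Qed.

Lemma proper_ideal_sub_maximal I : is_ideal R I -> ~ I 1 ->
  exists M, is_maximal R M /\ subset I M.
Proof.
move=> idI nI1; have [_ ->//|M [maxM IM]] :=
  @exists_maximal_disjoint_from (fun z => z = 1) _ idI.
by exists M; split=> //; apply/maximal_disjoint_from1.
Qed.

Lemma principal_ideal x : R x -> is_ideal R (fun z => exists2 r, R r & z = x * r).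
Proof.
move=> Rx; have [R0 R1 RB RM] := subR; split.
- by move=> _ [r Rr ->]; apply: RM.
- by exists 0; rewrite ?mulr0.
- by move=> _ _ [r Rr ->] [s Rs ->]; exists (r + s); [exact: subring_add | ring].
- by move=> t _ Rt [r Rr ->]; exists (t * r); [exact: RM | ring].
Qed.

(** * Localization at a prime ideal *)

Section Prime.
Variable P : K -> Prop.
Hypothesis primeP : is_prime R P.

Lemma prime_compl1 : ~ P 1.
Proof. by case: primeP. Qed.

Lemma prime_compl_mul a b : R a -> R b -> ~ P a -> ~ P b -> ~ P (a * b).
Proof. by case: primeP => _ _ PP Ra Rb nPa nPb /(PP _ _ Ra Rb)[]. Qed.

Lemma prime_compl_neq0 s : ~ P s -> s != 0.
Proof. by case: primeP => -[_ P0 _ _] _ _ nPs; apply/eqP => s0; rewrite s0 in nPs. Qed.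

Lemma localization_sub : subset R (localization R P).
Proof.
case: subR => _ R1 _ _ r Rr; exists r, 1; split=> //; first exact: prime_compl1.
by rewrite divr1.
Qed.

Lemma localization_inv s : R s -> ~ P s -> localization R P s^-1.
Proof. by case: subR => _ R1 _ _ Rs nPs; exists 1, s; rewrite mul1r. Qed.

Lemma localization_add a b : localization R P a -> localization R P b ->
  localization R P (a + b).
Proof.
case: subR => _ _ _ RM [a' [s [Ra Rs nPs ->]]] [b' [t [Rb Rt nPt ->]]].
exists (a' * t + b' * s), (s * t); split.
- by apply: subring_add; apply: RM.
- exact: RM.
- exact: prime_compl_mul.
- by field; rewrite !prime_compl_neq0.
Qed.

Lemma localization_mul a b : localization R P a -> localization R P b ->
  localization R P (a * b).
Proof.
case: subR => _ _ _ RM [a' [s [Ra Rs nPs ->]]] [b' [t [Rb Rt nPt ->]]].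
exists (a' * b'), (s * t); split; [exact: RM | exact: RM | exact: prime_compl_mul |].
by field; rewrite !prime_compl_neq0.
Qed.

End Prime.

(** * The ideal J = x R_M ∩ R of the overview *)

Definition contraction (x : K) (M : K -> Prop) : K -> Prop :=
  fun z => R z /\ exists2 t, localization R M t & z = x * t.

Section Contraction.
Variables (x : K) (M : K -> Prop).
Hypotheses (Rx : R x) (primeM : is_prime R M).

Lemma contraction_ideal : is_ideal R (contraction x M).
Proof.
have [R0 R1 RB RM] := subR; split.
- by move=> z [].
- by split=> //; exists 0; rewrite ?mulr0 //; apply: localization_sub.
- move=> y z [Ry [a La yE]] [Rz [b Lb zE]]; split; first exact: subring_add.
  by exists (a + b); [exact: localization_add | rewrite yE zE; ring].
- move=> r z Rr [Rz [a La zE]]; split; first exact: RM.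
  exists (r * a); last by rewrite zE; ring.
  by apply: localization_mul => //; apply: localization_sub.
Qed.

Lemma contraction_id : contraction x M x.
Proof.
have [_ R1 _ _] := subR; split=> //; exists 1; rewrite ?mulr1 //.
exact: localization_sub.
Qed.

Lemma principal_extend_contraction :
  principal (localization R M) (extend R M (contraction x M)).
Proof.
exists x => z; split=> [zJ|[t [Lt ->]] X JX X0 XD XM]; last first.
  by rewrite mulrC; apply: XM => //; apply: JX; apply: contraction_id.
apply: (zJ (fun y => exists t, localization R M t /\ y = x * t))
    => [_ [_ [t Lt ->]]||_ _ [a [La ->]] [b [Lb ->]]|t _ Lt [a [La ->]]].
- by exists t.
- by exists 0; rewrite mulr0; split=> //; apply: localization_sub => //; case: subR.
- by exists (a + b); split; [exact: localization_add | ring].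
- by exists (t * a); split; [exact: localization_mul | ring].
Qed.

(** Otherwise x J^-1 lies in [M], so J J^-1 is contained in x R_M J^-1, hence in M R_M, which does
    not contain 1. *)
Lemma contraction_colon_not_sub :
  invertible R (contraction x M) ->
  exists2 u, colon R (contraction x M) u & ~ M (x * u).
Proof.
move=> invJ; have [R0 R1 RB RM] := subR.
have [[MR M0 MD MM] _ _] := primeM.
apply: contrapT => noU.
have colM u : colon R (contraction x M) u -> M (x * u).
  by move=> cu; apply: contrapT => nMu; apply: noU; exists u.
have [_ /(_ R1) one_in] := invJ 1.
(* This is M R_M, used as the test set in the definition of [span]; 1 = m / s would put [s] in
   [M]. *)
pose MRM z := exists m s, [/\ M m, R s, ~ M s & z = m / s].
have [m [s [Mm Rs nMs E]]] : MRM 1; last first.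
  by apply: (nMs); rewrite -[s]mul1r E mulfVK // (prime_compl_neq0 primeM).
apply: (one_in MRM).
- move=> _ [_ [u [[_ [_ [a [s [Ra Rs nMs ->]]] ->]] cu ->]]].
  exists (a * (x * u)), s; split=> //; last by ring.
  by apply: MM => //; apply: colM.
- by exists 0, 1; rewrite mul0r; split=> //; apply: prime_compl1.
- move=> _ _ [m [s [Mm Rs nMs ->]]] [n [t [Mn Rt nMt ->]]].
  exists (t * m + s * n), (s * t); split.
  + by apply: MD; apply: MM.
  + exact: RM.
  + exact: prime_compl_mul.
  + by field; rewrite !(prime_compl_neq0 primeM).
- move=> r _ Rr [m [s [Mm Rs nMs ->]]].
  by exists (r * m), s; rewrite mulrA; split=> //; apply: MM.
Qed.

End Contraction.

(** * Invertibility of J and its consequence at the other maximal ideals *)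

Lemma principal_extend_not_sub I N : is_prime R N -> subset I R ->
  (exists2 z, I z & ~ N z) -> principal (localization R N) (extend R N I).
Proof.
move=> primeN IR [s Is nNs]; have [R0 _ _ _] := subR.
(* The element [s] of [I] is a unit of R_N, so the extension is all of R_N and 1 generates it. *)
exists 1 => z; split=> [zI|[t [Lt ->]] X IX _ _ XM]; last first.
  rewrite mul1r -[t](mulfVK (prime_compl_neq0 primeN nNs)).
  apply: XM; last exact: IX.
  by apply: localization_mul => //; apply: localization_inv => //; apply: IR.
exists z; rewrite mul1r; split=> //.
apply: (zI (localization R N)); first by move=> y /IR; apply: localization_sub.
- exact: localization_sub.
- by move=> a b; apply: localization_add.
- by move=> a b; apply: localization_mul.
Qed.

(** A concrete form of R_M R_N = K. If the product of the complements of [M] and [N] misses xR, some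
    prime containing [x] is disjoint from it and so lies in both [M] and [N], against uniqueness. *)
Lemma contraction_not_sub x M N : R x -> x != 0 -> prime_in_unique_maximal R ->
  is_maximal R M -> is_maximal R N -> N <> M ->
  exists2 z, contraction x M z & ~ N z.
Proof.
move=> Rx x0 uniqR maxM maxN neqNM; have [R0 R1 RB RM] := subR.
have primeM := maximal_prime maxM; have primeN := maximal_prime maxN.
pose S z := exists s t, [/\ R s, R t, ~ M s, ~ N t & z = s * t].
have [[_ [[s [t [Rs Rt nMs nNt ->]]] [r Rr stE]]]|xS] :=
    pselect (exists z, S z /\ (exists2 r, R r & z = x * r)).
  (* From s t = x r comes t = x (r / s), an element of x R_M outside [N]. *)
  exists t => //; split=> //; exists (r / s); first by exists r, s.
  by rewrite mulrA -stE mulrC mulKf ?(prime_compl_neq0 primeM).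
have [z Sz xz|P [maxP xP]] :=
    @exists_maximal_disjoint_from S _ (principal_ideal Rx).
  by apply: xS; exists z.
have primeP : is_prime R P.
  apply: (maximal_disjoint_from_prime _ _ maxP).
    exists 1, 1; rewrite mulr1; split=> //; exact: prime_compl1.
  move=> _ _ [s [t [Rs Rt nMs nNt ->]]] [s' [t' [Rs' Rt' nMs' nNt' ->]]].
  exists (s * s'), (t * t'); split; [exact: RM | exact: RM | | | by ring];
    exact: prime_compl_mul.
have [[PR _ _ _] SP _] := maxP.
have PM : subset P M.
  move=> z Pz; apply: contrapT => nMz; apply: SP (Pz).
  by exists z, 1; rewrite mulr1; split=> //; [exact: PR | exact: prime_compl1].
have PN : subset P N.
  move=> z Pz; apply: contrapT => nNz; apply: SP (Pz).
  by exists 1, z; rewrite mul1r; split=> //; [exact: PR | exact: prime_compl1].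
have [|Q [_ _ uniqQ]] := uniqR P primeP.
  by exists x; split=> //; apply: xP; exists 1; rewrite ?mulr1.
case: neqNM; rewrite (seteq_eq (uniqQ _ maxM PM)).
exact: seteq_eq (uniqQ _ maxN PN).
Qed.

Lemma contraction_invertible x M : R x -> x != 0 -> LPI R ->
  prime_in_unique_maximal R -> is_maximal R M -> invertible R (contraction x M).
Proof.
move=> Rx x0 lpiR uniqR maxM; have primeM := maximal_prime maxM.
have idJ := contraction_ideal x primeM.
apply: lpiR => // [|N maxN].
  by exists x; split=> //; apply: contraction_id.
have [->|neqNM] := pselect (N = M); first exact: principal_extend_contraction.
apply: principal_extend_not_sub; first exact: maximal_prime.
  by case: idJ.
exact: contraction_not_sub.
Qed.

Lemma exists_notin_maximal_in_others x M : R x -> x != 0 -> LPI R ->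
  prime_in_unique_maximal R -> is_maximal R M ->
  exists c, [/\ R c, ~ M c &
    forall N, is_maximal R N -> N <> M -> contraction x N c].
Proof.
move=> Rx x0 lpiR uniqR maxM; have primeM := maximal_prime maxM.
have [u cu nMu] := contraction_colon_not_sub primeM
  (contraction_invertible Rx x0 lpiR uniqR maxM).
have Rxu : R (x * u) by rewrite mulrC; apply/cu/contraction_id.
exists (x * u); split=> // N maxN neqNM; split=> //.
have [j Jj nNj] := contraction_not_sub Rx x0 uniqR maxM maxN neqNM.
have primeN := maximal_prime maxN.
(* Since [u * j] is in [R] and [j] is outside [N], the fraction (u j) / j shows that [u] lies in
   R_N. *)
exists u => //; exists (u * j), j; split=> //; [exact: cu | by case: Jj |].
by rewrite mulfK ?(prime_compl_neq0 primeN).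
Qed.

(** * Finiteness of the set of exceptional maximal ideals *)

Definition almost_everywhere_multiple (x : K) : K -> Prop :=
  fun r => R r /\ exists Ms : seq (K -> Prop),
    forall N, is_maximal R N -> N \notin Ms -> contraction x N r.

Lemma almost_everywhere_multiple_ideal x :
  is_ideal R (almost_everywhere_multiple x).
Proof.
have [R0 _ _ RM] := subR; split.
- by move=> r [].
- split=> //; exists [::] => N /maximal_prime primeN _.
  by have [_ ? _ _] := contraction_ideal x primeN.
- move=> a b [Ra [Ms Msa]] [Rb [Ns Nsb]]; split; first exact: subring_add.
  exists (Ms ++ Ns) => N maxN; rewrite mem_cat negb_or => /andP[NMs NNs].
  have [_ _ JD _] := contraction_ideal x (maximal_prime maxN).
  by apply: JD; [exact: Msa | exact: Nsb].
- move=> r a Rr [Ra [Ms Msa]]; split; first exact: RM.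
  exists Ms => N maxN NMs.
  have [_ _ _ JM] := contraction_ideal x (maximal_prime maxN).
  by apply: JM => //; apply: Msa.
Qed.

(** A maximal ideal [M] containing this ideal would contain the element [c] attached to [M], whose
    only exception is [M] itself; but [c] is outside [M]. *)
Lemma almost_everywhere_multiple1 x : R x -> x != 0 -> LPI R ->
  prime_in_unique_maximal R -> almost_everywhere_multiple x 1.
Proof.
move=> Rx x0 lpiR uniqR; apply: contrapT => nB1.
have [M [maxM BM]] :=
  proper_ideal_sub_maximal (almost_everywhere_multiple_ideal x) nB1.
have [c [Rc nMc cN]] := exists_notin_maximal_in_others Rx x0 lpiR uniqR maxM.
apply/nMc/BM; split=> //; exists [:: M] => N maxN.
by rewrite inE => /eqP neqNM; apply: cN.
Qed.

Lemma contraction1_notin x M : R x -> is_prime R M -> contraction x M 1 -> ~ M x.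
Proof.
move=> Rx primeM [_ [_ [a [s [Ra Rs nMs ->]]] E]] Mx; apply: (nMs).
have [[_ _ _ MM] _ _] := primeM.
have -> : s = a * x; last exact: MM.
(* Clearing the denominator in 1 = x (a / s). *)
by rewrite -[LHS]mul1r E mulrA mulfVK 1?mulrC // (prime_compl_neq0 primeM).
Qed.

End Ideals.

Theorem theorem12 (K : fieldType) (R : K -> Prop) :
  is_subring R -> is_quotient_field R -> (exists x : K, ~ R x) ->
  finitely_stable R -> LPI R -> prime_in_unique_maximal R ->
  finite_character R.
Proof.
move=> subR _ _ _ lpiR uniqR x Rx x0.
have [_ [Ms MsP]] := almost_everywhere_multiple1 subR Rx x0 lpiR uniqR.
(* Outside the exceptional list [x] is a unit of R_M, so every maximal ideal containing [x] is
   listed. *)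
exists Ms => M maxM Mx; have [MMs|nMs] := boolP (M \in Ms); last first.
  by case: (contraction1_notin Rx (maximal_prime subR maxM) (MsP _ maxM nMs)).
by exists (index M Ms); rewrite ?index_mem ?nth_index.
Qed.
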